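(* Let $\phi$ be a CLTLB($\mathcal{D}$) formula and let $\rho=\alpha\beta^\omega\in SV(\phi)^\omega$ be an ultimately periodic word with $\alpha=\alpha's$ and $\beta=\beta's$ (for some $s\in SV(\phi)$), and let $k=|\alpha\beta|-1$. Then there is a non-strict (resp. strict) infinite forward path in $\rho$ if, and only if, there are two points $p,p'$ of $\rho$ such that $\mathit{sv}(p)=|\alpha'|$, $\mathit{sv}(p')=k$, $p\equiv p'$, and $p\stackrel{\preccurlyeq}{\frown}p'$ (resp. $p\stackrel{\prec}{\frown}p'$).
   Context: $\mathcal{D}$ is a constraint system over a domain $D$ with a strict total order $<$ and equality among its relations (e.g. $(D,<,=)$ or $\mathrm{IPC}^*$ over $\mathbb{Z}$); $V$ is a finite set of variables. A.t.t.'s: $\alpha::=c\mid x\mid\mathrm{X}\alpha\mid\mathrm{Y}\alpha$, depth $|c|=|x|=0$, $|\mathrm{X}\alpha|=|\alpha|+1$, $|\mathrm{Y}\alpha|=|\alpha|-1$. CLTLB($\mathcal{D}$) formulae are built from atomic relations $R(\alpha_1,\dots,\alpha_n)$ over a.t.t.'s with $\wedge,\neg,\mathbf{X},\mathbf{Y},\mathbf{U},\mathbf{S}$. $\lceil\phi\rceil$ / $\lfloor\phi\rfloor$: max / min of $0$ and depths of a.t.t.'s of $\phi$; $\lambda=\lceil\phi\rceil-\lfloor\phi\rfloor+1$. $\mathit{terms}(\phi)$: $\mathrm{X}^ix$ ($0\le i\le\lceil\phi\rceil$), $\mathrm{Y}^ix$ ($1\le i\le-\lfloor\phi\rfloor$),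 $x\in V$; $\mathit{const}(\phi)$: constants of $\phi$ (for discrete $D$, all values between the least and greatest). A symbolic valuation is a consistent (terms treated as distinct fresh variables) and maximal set of $\mathcal{D}$-constraints over $\mathit{terms}(\phi)\cup\mathit{const}(\phi)$; $SV(\phi)$ is their set; $sv\models_{sym}\xi$ iff every assignment satisfying $sv$ satisfies $\xi$. Graph: vertices are pairs $(x,a)$, $x\in V\cup\mathit{const}(\phi)$, $a$ an absolute position; there is an edge from $(x,a)$ to $(y,b)$ labeled $\sim\in\{<,=\}$ iff there is $l\ge0$ with $a-l,b-l\in[\lfloor\phi\rfloor,\lceil\phi\rceil]$ and $(\mathrm{X}^{a-l}x\sim\mathrm{X}^{b-l}y)\in\rho(l)$ ($\mathrm{X}^{-n}$ meaning $\mathrm{Y}^n$). An infinite forward (resp. backward) path is a sequence $d:\mathbb{N}\to$ vertices such that for all $i$ there is an edge from $d(i)$ to $d(i+1)$ (resp. from $d(i+1)$ to $d(i)$) and the position of $d(i)$ is $\le$ that of $d(i+1)$; it is strict if infinitely many of these edges are labeled $<$. A path ''in $\rho$'' is a path in this graph. Points: a point is $p=(x,j,h)$ with $x\in V\cup\mathit{const}(\phi)$, $j\ge0$, $h\in[\lfloor\phi\rfloor,\lceil\phi\rceil]$, $\mathit{var}(p)=x$, $\mathit{sv}(p)=j$, $\mathit{shift}(p)=h$, representing vertex $(x,j+h)$. For $p_1=(x,j,h)$, $p_2=(y,i,m)$: $p_1\preccurlyeq p_2$ iff (1) $i+m-(j+h)<\lambda$, (2) $j+h\le i+m$, (3) for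 a position $l\ge0$ with $j+h-l,i+m-l\in[\lfloor\phi\rfloor,\lceil\phi\rceil]$, $\rho(l)\models_{sym}\mathrm{X}^{j+h-l}x\le\mathrm{X}^{i+m-l}y$. $\prec,\approx,\succcurlyeq,\succ$: same with $\le$ replaced by $<,=,\ge,>$. $\stackrel{\preccurlyeq}{\frown},\stackrel{\approx}{\frown},\stackrel{\succcurlyeq}{\frown}$ are the transitive closures of $\preccurlyeq,\approx,\succcurlyeq$; $p_1\stackrel{\prec}{\frown}p_2$ iff $p_1\stackrel{\preccurlyeq}{\frown}p'\prec p''\stackrel{\preccurlyeq}{\frown}p_2$ for some $p',p''$; $p_1\stackrel{\succ}{\frown}p_2$ iff $p_1\stackrel{\succcurlyeq}{\frown}p'\succ p''\stackrel{\succcurlyeq}{\frown}p_2$ for some $p',p''$. $p\equiv p'$ iff same variable, same shift, and $\mathit{sv}(p')=\mathit{sv}(p)+i|\beta|$ for some $i\in\mathbb{Z}$.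
   Formalization: The word ρ is additionally assumed locally consistent (successive symbolic valuations agree on shared terms), and non-strict forward paths must reach unbounded positions; without these, clashing valuations or self-loops x = x give paths with no matching points p, p'. *)

(* Defs.v *)
From Stdlib Require Export Relations.Relation_Operators.
From mathcomp Require Export all_boot all_order all_algebra.

Set Implicit Arguments.
Unset Strict Implicit.
Unset Printing Implicit Defensive.

Import Order.TTheory GRing.Theory Num.Theory.
Local Open Scope ring_scope.

(* The relations of the constraint system other than < and =, which every
   system is required to have (see [symbol]) and which are interpreted by the
   order and the equality of D. *)
Record constraint_system (disp : Order.disp_t) (D : orderType disp) :=
  ConstraintSystem {
    other : Type;
    other_arity : other -> nat;
    other_interp : forall R : other, (other_arity R).-tuple D -> Prop
  }.

Section CLTLB.
Variables (disp : Order.disp_t) (D : orderType disp).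
Variables (CS : constraint_system D) (V : finType).

Inductive symbol := SymLt | SymEq | SymOther of other CS.

Definition arity (R : symbol) : nat :=
  match R with SymLt | SymEq => 2 | SymOther R' => other_arity R' end.

Definition interp (R : symbol) : (arity R).-tuple D -> Prop :=
  match R with
  | SymLt => fun t : 2.-tuple D => (tnth t ord0 < tnth t ord_max)%O
  | SymEq => fun t : 2.-tuple D => tnth t ord0 = tnth t ord_max
  | SymOther R' => fun t => other_interp t
  end.

(* Arithmetic temporal terms (a.t.t.'s). *)
Inductive att := Cst of D | Var of V | NextT of att | PrevT of att.

Fixpoint depth (a : att) : int :=
  match a with
  | Cst _ | Var _ => 0
  | NextT b => depth b + 1
  | PrevT b => depth b - 1
  end.

Fixpoint att_consts (a : att) : seq D :=
  match a with
  | Cst c => [:: c]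
  | Var _ => [::]
  | NextT b | PrevT b => att_consts b
  end.

Record constraint := Constraint {
  csym : symbol;
  cargs : (arity csym).-tuple att
}.

Definition lt_constraint (t u : att) : constraint :=
  @Constraint SymLt [tuple t; u].
Definition eq_constraint (t u : att) : constraint :=
  @Constraint SymEq [tuple t; u].

Inductive formula :=
  | FAtom of constraint
  | FAnd of formula & formula
  | FNot of formula
  | FNext of formula
  | FPrev of formula
  | FUntil of formula & formula
  | FSince of formula & formula.

Fixpoint atts (phi : formula) : seq att :=
  match phi with
  | FAtom k => cargs k
  | FAnd f g | FUntil f g | FSince f g => atts f ++ atts g
  | FNot f | FNext f | FPrev f => atts f
  end.

Definition fceil (phi : formula) : int :=
  \big[Num.max/0]_(a <- atts phi) depth a.
Definition ffloor (phi : formula) : int :=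
  \big[Num.min/0]_(a <- atts phi) depth a.
Definition lambda (phi : formula) : int := fceil phi - ffloor phi + 1.

Definition in_window (phi : formula) (h : int) : bool :=
  ffloor phi <= h <= fceil phi.

Definition formula_consts (phi : formula) : seq D :=
  flatten [seq att_consts a | a <- atts phi].

(* Discreteness in the sense of nat and int: bounded intervals are finite.
   Under the weaker requirement that successors and predecessors exist,
   [const phi] below could be infinite. *)
Definition discrete : Prop :=
  forall a b : D, exists l : seq D, forall c : D, (a <= c <= b)%O -> c \in l.

Definition const (phi : formula) (c : D) : Prop :=
  c \in formula_consts phi \/
  (discrete /\ exists a b : D,
     [/\ a \in formula_consts phi, b \in formula_consts phi & (a <= c <= b)%O]).

(* V together with the constants; membership in the finite set V \cup const(phi)
   is [in_base phi]. *)
Definition base : Type := (V + D)%type.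

Definition in_base (phi : formula) (x : base) : Prop :=
  match x with inl _ => True | inr c => const phi c end.

(* X^h x, where X^(-n) is Y^n. Constants are rigid, so X^h c is c itself. *)
Definition xpow (h : int) (x : base) : att :=
  match x with
  | inr c => Cst c
  | inl y => match h with
             | Posz n => iter n NextT (Var y)
             | Negz n => iter n.+1 PrevT (Var y)
             end
  end.

(* terms(phi) \cup const(phi) *)
Definition sym_term (phi : formula) (t : att) : Prop :=
  exists (x : base) (h : int), [/\ in_base phi x, in_window phi h & t = xpow h x].

Definition constraint_over (phi : formula) (k : constraint) : Prop :=
  forall i : 'I_(arity (csym k)), sym_term phi (tnth (cargs k) i).

(* Assignments give values to whole terms: distinct non-constant terms are
   independent variables, and only the constants have a fixed value. *)
Definition assignment (v : att -> D) : Prop := forall c : D, v (Cst c) = c.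

Definition sat (v : att -> D) (k : constraint) : Prop :=
  interp (map_tuple v (cargs k)).

Definition sat_all (v : att -> D) (S : constraint -> Prop) : Prop :=
  forall k : constraint, S k -> sat v k.

Definition consistent (S : constraint -> Prop) : Prop :=
  exists v : att -> D, assignment v /\ sat_all v S.

(* S \in SV(phi) *)
Definition SV (phi : formula) (S : constraint -> Prop) : Prop :=
  [/\ forall k, S k -> constraint_over phi k,
      consistent S
    & forall S' : constraint -> Prop,
        (forall k, S' k -> constraint_over phi k) -> consistent S' ->
        (forall k, S k -> S' k) -> forall k, S' k -> S k].

(* sv |=sym (t r u), for a comparison r of D such as <= or <. *)
Definition sym_entails (sv : constraint -> Prop) (r : rel D) (t u : att) :
    Prop :=
  forall v : att -> D, assignment v -> sat_all v sv -> r (v t) (v u).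

(* Successive symbolic valuations agree on the terms that they share: what is
   X^h x at position i is X^(h-1) x at position i+1. *)
Definition locally_consistent (phi : formula)
    (rho : nat -> constraint -> Prop) : Prop :=
  forall (i : nat) (R : symbol) (args : (arity R).-tuple (base * int)),
    (forall j, [/\ in_base phi (tnth args j).1,
                   in_window phi (tnth args j).2
                 & in_window phi ((tnth args j).2 - 1)]) ->
    rho i (@Constraint R (map_tuple (fun p => xpow p.2 p.1) args)) ->
    rho i.+1 (@Constraint R (map_tuple (fun p => xpow (p.2 - 1) p.1) args)).

Definition vertex : Type := (base * int)%type.

(* The edge label ~ is given as the map (t, u) |-> (t ~ u). *)
Definition edge (phi : formula) (rho : nat -> constraint -> Prop)
    (label : att -> att -> constraint) (p q : vertex) : Prop :=
  exists l : nat,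
    [/\ in_window phi (p.2 - l%:Z), in_window phi (q.2 - l%:Z)
      & rho l (label (xpow (p.2 - l%:Z) p.1) (xpow (q.2 - l%:Z) q.1))].

Definition forward_path (phi : formula) (rho : nat -> constraint -> Prop)
    (d : nat -> vertex) : Prop :=
  forall i : nat,
    [/\ in_base phi (d i).1,
        edge phi rho lt_constraint (d i) (d i.+1) \/
        edge phi rho eq_constraint (d i) (d i.+1)
      & (d i).2 <= (d i.+1).2].

Definition strict_path (phi : formula) (rho : nat -> constraint -> Prop)
    (d : nat -> vertex) : Prop :=
  forall n : nat, exists i : nat,
    (n <= i)%N /\ edge phi rho lt_constraint (d i) (d i.+1).

(* The sequence does not stay forever at one position, for instance on a
   reflexive edge x = x. *)
Definition progressing (d : nat -> vertex) : Prop :=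
  forall n : nat, exists i : nat, n%:Z <= (d i).2.

Record point := Point { pvar : base; psv : nat; pshift : int }.

Definition is_point (phi : formula) (p : point) : Prop :=
  in_base phi (pvar p) /\ in_window phi (pshift p).

Definition ppos (p : point) : int := (psv p)%:Z + pshift p.

(* For r being <= and <, these are the relations \preccurlyeq and \prec. *)
Definition point_rel (phi : formula) (rho : nat -> constraint -> Prop)
    (r : rel D) (p1 p2 : point) : Prop :=
  [/\ is_point phi p1 /\ is_point phi p2,
      ppos p2 - ppos p1 < lambda phi,
      ppos p1 <= ppos p2
    & exists l : nat,
        [/\ in_window phi (ppos p1 - l%:Z), in_window phi (ppos p2 - l%:Z)
          & sym_entails (rho l) r (xpow (ppos p1 - l%:Z) (pvar p1))
                                  (xpow (ppos p2 - l%:Z) (pvar p2))]].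

Definition preceq_chain (phi : formula) (rho : nat -> constraint -> Prop) :
    point -> point -> Prop :=
  clos_trans point (point_rel phi rho (fun a b => (a <= b)%O)).

Definition prec_chain (phi : formula) (rho : nat -> constraint -> Prop)
    (p1 p2 : point) : Prop :=
  exists p' p'' : point,
    [/\ preceq_chain phi rho p1 p',
        point_rel phi rho (fun a b => (a < b)%O) p' p''
      & preceq_chain phi rho p'' p2].

(* n is the length of the period. *)
Definition point_equiv (n : nat) (p p' : point) : Prop :=
  [/\ pvar p = pvar p', pshift p = pshift p'
    & exists i : int, (psv p')%:Z = (psv p)%:Z + i * n%:Z].

End CLTLB.

(* The infinite word a b^omega; x0 is irrelevant when b is not empty. *)
Definition lasso (T : Type) (x0 : T) (a b : seq T) (i : nat) : T :=
  if (i < size a)%N then nth x0 a i else nth x0 b ((i - size a) %% size b)%N.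

(* Main.v *)
(* Fix an assignment satisfying each symbolic valuation. By maximality it
   decides every order constraint between visible vertices, so a chain is a
   position-monotone sequence of vertices whose values are locally
   nondecreasing. The key point (reach_back) is that a vertex whose value is at
   least that of a chain's end is also reached by a chain even if its position
   is earlier, as long as it is not before the start of the chain. An infinite path crosses every copy of the
   window at |alpha'|; reading these crossings back in the single valuation s
   gives values a_j in a finite set, so a_(j+1) <= a_j for some j (with
   strictness where needed). By reach_back the j-th crossing then reaches its
   own translate by one period, not merely by some multiple of the period.
   Conversely, a chain from a vertex to its translate is repeated forever. *)

Require Import Defs.
From Stdlib Require Import Classical ClassicalEpsilon.
From mathcomp Require Import zify.

Set Implicit Arguments.
Unset Strict Implicit.
Unset Printing Implicit Defensive.

Import Order.TTheory GRing.Theory Num.Theory.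
Local Open Scope ring_scope.

(** Each strict increase raises the number of elements of [L] below the current value, and that
    number is at most [size L]. *)
Lemma finite_nondecreasing_stabilizes (disp : Order.disp_t) (D : orderType disp)
    (L : seq D) (a : nat -> D) :
  (forall j, a j \in L) -> (forall j, (a j <= a j.+1)%O) ->
  exists n, forall j, (n <= j)%N -> a j.+1 = a j.
Proof.
move=> aL a_nd; apply: NNPP => no_stab.
have a_inc n : exists2 j, (n <= j)%N & (a j < a j.+1)%O.
  apply: NNPP => no_inc; apply: no_stab; exists n => j nj.
  case: (eqVneq (a j.+1) (a j)) => // neq.
  by case: no_inc; exists j; rewrite ?lt_neqAle ?a_nd 1?eq_sym ?neq.
have a_homo i j : (i <= j)%N -> (a i <= a j)%O.
  by move=> ij; apply: (homo_leq (r := <=%O)) ij => // ? ? ?; apply: le_trans.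
have count_large n : exists j, (n <= count (fun y => (y < a j)%O) L)%N.
  elim: n => [|n [i ni]]; first by exists 0.
  have [j ij aj] := a_inc i; exists j.+1; apply: leq_ltn_trans ni _.
  have a_lt : (a i < a j.+1)%O by apply: le_lt_trans aj; apply: a_homo.
  (* The occurrence of [a i] in [L] is counted below [a j.+1] but not below [a i] itself. *)
  rewrite !(permP (perm_to_rem (aL i))) /= ltxx a_lt ltnS.
  by apply: sub_count => y ya; apply: lt_trans ya a_lt.
have [j] := count_large (size L).+1.
by rewrite ltnNge count_size.
Qed.

(** * Chains of vertices over an abstract family of window values *)

Section Reachability.

Context {disp : Order.disp_t} {D : orderType disp} {B : Type}.
(* [g l u] is the value of u seen from position l; values seen from different
   positions are unrelated, only their order is shared. *)
Context (inb : B -> Prop) (lo hi : int) (g : nat -> B * int -> D).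

Definition visible (l : nat) (u : B * int) : bool := lo <= u.2 - l%:Z <= hi.

(* The flag C is true for the non-strict relation, as in [Order.lteif]. *)
Definition step (C : bool) (u w : B * int) : Prop :=
  [/\ inb u.1, inb w.1, u.2 <= w.2
    & exists l, [/\ visible l u, visible l w
                  & Order.lteif (g l u) (g l w) C]].

(** The flag is the conjunction of the step flags, so [reach false] records that at least one step
    was taken strictly. *)
Inductive reach : bool -> B * int -> B * int -> Prop :=
  | reach_refl u : reach true u u
  | reach_step C C' u w z : reach C u w -> step C' w z -> reach (C && C') u z.

Lemma step_weaken C u w : step C u w -> step true u w.
Proof.
case=> ? ? ? [l [? ? c]]; split=> //; exists l; split=> //.
by apply: lteif_imply c; apply: implybT.
Qed.

Lemma reach1 C u w : step C u w -> reach C u w.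
Proof. exact: reach_step (reach_refl u). Qed.

Lemma reach_trans C C' u w z :
  reach C u w -> reach C' w z -> reach (C && C') u z.
Proof.
move=> uw wz; elim: wz uw => [v|C1 C2 v w' z' _ IH st] uw.
  by rewrite andbT.
by rewrite andbA; apply: reach_step (IH uw) st.
Qed.

Lemma reach_le C u w : reach C u w -> u.2 <= w.2.
Proof. by elim=> // C1 C2 v w' z _ IH [_ _ + _]; apply: le_trans. Qed.

(** Positions never decrease along a chain, so a lower bound on its start holds at every step. *)
Lemma reach_map (lb : int) (F : B * int -> B * int) C (u w : B * int) :
  (forall C (u w : B * int), lb <= u.2 -> step C u w -> step C (F u) (F w)) ->
  lb <= u.2 -> reach C u w -> reach C (F u) (F w).
Proof.
move=> stepF lbu r; elim: r lbu => [v|C1 C2 v w' z r IH st] lbv.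
  exact: reach_refl.
apply: reach_step (IH lbv) (stepF _ _ _ _ st).
exact: le_trans lbv (reach_le r).
Qed.

Lemma reach_seq C u w : reach C u w ->
  exists (m : nat) (e : nat -> B * int),
    [/\ e 0%N = u, e m = w, forall i, (i < m)%N -> step true (e i) (e i.+1)
      & ~~ C -> exists2 i, (i < m)%N & step false (e i) (e i.+1)].
Proof.
elim=> [v|C1 C2 v w' z r [m [e [e0 em est estrict]]] st].
  by exists 0%N, (fun=> v); split.
exists m.+1, (fun i => if (i <= m)%N then e i else z); split=> //.
- by rewrite ltnn.
- move=> i; rewrite ltnS => im; rewrite im.
  case: ltnP => [|mi]; first exact: est.
  have -> : i = m by lia.
  by rewrite em; apply: step_weaken st.
- rewrite negb_and; case: C2 st => [|st _]; last first.
    by exists m; rewrite // leqnn ltnn em.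
  rewrite orbF => _ /estrict [i im sti].
  by exists i; [apply: ltnW | rewrite (ltnW im) im].
Qed.

Lemma step_chain d i j : (i <= j)%N ->
  (forall i : nat, step true (d i) (d i.+1)) -> reach true (d i) (d j).
Proof.
move=> ij dst; rewrite -(subnKC ij); elim: (j - i)%N => [|m IH].
  by rewrite addn0; apply: reach_refl.
by rewrite addnS; apply: (reach_step IH).
Qed.

Hypothesis g_local1 : forall (C : bool) (l : nat) (u w : B * int),
  inb u.1 -> inb w.1 -> visible l u -> visible l w ->
  visible l.+1 u -> visible l.+1 w ->
  Order.lteif (g l u) (g l w) C = Order.lteif (g l.+1 u) (g l.+1 w) C.

(** Two windows that both contain [u] and [w] are joined by consecutive windows that all contain
    both. *)
Lemma g_local C l l' u w :
  inb u.1 -> inb w.1 -> visible l u -> visible l w ->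
  visible l' u -> visible l' w ->
  Order.lteif (g l u) (g l w) C = Order.lteif (g l' u) (g l' w) C.
Proof.
move=> bu bw; wlog ll' : l l' / (l <= l')%N => [W|].
  by case: (leqP l l') => [|/ltnW] ll' *; [|symmetry]; apply: W ll' _ _ _ _.
rewrite -(subnKC ll'); elim: (l' - l)%N => [|m IH] lu lw lu' lw'.
  by rewrite addn0.
have [mu mw] : visible (l + m) u /\ visible (l + m) w.
  by move: lu lw lu' lw'; rewrite /visible; lia.
by rewrite IH // addnS g_local1 // -addnS.
Qed.

(* The edge straddling the position of v has its window contain v, so the
   chain can be left at the start of that edge. *)
Lemma reach_back C C' l u w v :
  reach C u w -> inb w.1 -> inb v.1 -> visible l w -> visible l v ->
  Order.lteif (g l w) (g l v) C' -> u.2 <= v.2 -> reach (C && C') u v.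
Proof.
move=> r; elim: r C' l => {C u w} [u|C1 C2 u w' w r IH st] C' l.
  by move=> bu bv lu lv c uv; apply: reach1; split=> //; exists l.
have [bw' _ ww' [l' [l'w' l'w c']]] := st.
move=> bw bv lw lv c uv; case: (leP w.2 v.2) => [wv|vw].
  by apply: reach_step (reach_step r st) _; split=> //; exists l.
rewrite -andbA; case: (leP v.2 w'.2) => [vw'|w'v].
  have lw' : visible l w' by move: lw lv; rewrite /visible; lia.
  rewrite (g_local _ bw' bw l'w' l'w lw' lw) in c'.
  exact: IH bw' bv lw' lv (lteif_trans c' c) uv.
have l'v : visible l' v by move: l'w' l'w; rewrite /visible; lia.
rewrite (g_local _ bw bv lw lv l'w l'v) in c.
apply: reach_step r _; split=> //; first exact: ltW.
by exists l'; split=> //; apply: lteif_trans c' c.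
Qed.

Hypothesis g_finite : forall l, exists L : seq D,
  forall u, inb u.1 -> visible l u -> g l u \in L.

(** If positions stay bounded, they become constant, so one window sees the whole tail. Its values
    there are nondecreasing in a finite set, hence finally constant, which rules out later strict
    steps. *)
Lemma strict_progressing (d : nat -> B * int) :
  (forall i, step true (d i) (d i.+1)) ->
  (forall m, exists i, (m <= i)%N /\ step false (d i) (d i.+1)) ->
  forall m : nat, exists i, m%:Z <= (d i).2.
Proof.
move=> dst dstrict; apply: NNPP => /not_all_ex_not [m hm].
have d_lt i : (d i).2 < m%:Z.
  by rewrite ltNge; apply/negP => im; apply: hm; exists i.
have d_ge i : (d 0%N).2 <= (d i).2.
  exact: reach_le (step_chain (leq0n i) dst).
have [i0 i0st] : exists n, forall j, (n <= j)%N -> (d j.+1).2 = (d j).2.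
  apply: (@finite_nondecreasing_stabilizes _ _
    [seq (d 0%N).2 + i%:Z | i : nat <- iota 0 `|m%:Z - (d 0%N).2|]
    (fun j => (d j).2)).
  - move=> j; apply/mapP; exists `|(d j).2 - (d 0%N).2|%N.
      by rewrite mem_iota; have := d_lt j; have := d_ge j; lia.
    by have := d_ge j; lia.
  - by move=> j; case: (dst j).
have dE j : (i0 <= j)%N -> (d j).2 = (d i0).2.
  move=> ij; rewrite -(subnKC ij); elim: (j - i0)%N => [|k IH].
    by rewrite addn0.
  by rewrite addnS i0st ?leq_addr.
have [l dl] : exists l, visible l (d i0).
  by case: (dst i0) => _ _ _ [l [? _ _]]; exists l.
have vis j : (i0 <= j)%N -> visible l (d j).
  by move=> /dE; move: dl; rewrite /visible => + ->.
have dl_cmp C j : (i0 <= j)%N -> step C (d j) (d j.+1) ->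
    Order.lteif (g l (d j)) (g l (d j.+1)) C.
  move=> ij [b1 b2 _ [l' [v1 v2]]].
  by rewrite (g_local _ b1 b2 v1 v2 (vis _ ij) (vis _ (leqW ij))).
have [L gL] := g_finite l.
have [n nst] : exists n, forall j, (n <= j)%N ->
    g l (d (i0 + j.+1)%N) = g l (d (i0 + j)%N).
  apply: (@finite_nondecreasing_stabilizes _ _ L
    (fun j => g l (d (i0 + j)%N))) => j.
    by apply: gL; [case: (dst (i0 + j)%N) | apply: vis; rewrite leq_addr].
  by rewrite addnS; apply: (dl_cmp true); rewrite ?leq_addr.
have [i [ni sti]] := dstrict (i0 + n)%N.
have i0i : (i0 <= i)%N by lia.
have := dl_cmp false i i0i sti.
have := nst (i - i0)%N; rewrite addnS subnKC // => -> /=; last by lia.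
by rewrite ltxx.
Qed.

(** * Translation by periods *)

Context (A n : nat) (n_gt0 : (0 < n)%N).

Definition shift (z : int) (u : B * int) : B * int := (u.1, u.2 + z).

Hypothesis g_periodic : forall (l j : nat) (u : B * int), (A <= l)%N ->
  g (l + j * n) (shift (j * n)%:Z u) = g l u.

Lemma visible_shift l j u : visible (l + j) (shift j%:Z u) = visible l u.
Proof. by apply/idP/idP; rewrite /visible /=; lia. Qed.

(* Sliding the witnessing window as far right as possible puts it inside the
   periodic part. *)
Lemma step_late C (u w : B * int) : A%:Z + lo <= u.2 -> step C u w ->
  exists l, [/\ (A <= l)%N, visible l u, visible l w
              & Order.lteif (g l u) (g l w) C].
Proof.
move=> Au [bu bw uw [l [lu lw c]]]; exists `|u.2 - lo|%N.
have [vu vw] : visible `|u.2 - lo|%N u /\ visible `|u.2 - lo|%N w.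
  by move: lu lw; rewrite /visible; lia.
by split=> //; [lia | rewrite -(g_local _ bu bw lu lw vu vw)].
Qed.

Lemma step_shift j C (u w : B * int) : A%:Z + lo <= u.2 ->
  step C u w -> step C (shift (j * n)%:Z u) (shift (j * n)%:Z w).
Proof.
move=> Au st; have [l [Al lu lw c]] := step_late Au st.
case: st => bu bw uw _; split=> //=; first by rewrite lerD2r.
by exists (l + j * n)%N; rewrite !visible_shift !g_periodic.
Qed.

(** The witnessing window is slid right until [u] is at its left end; the extra [j * n] in the bound
    keeps it at or after [A] once it is moved back. *)
Lemma step_unshift j C (u w : B * int) : A%:Z + lo + (j * n)%:Z <= u.2 ->
  step C u w -> step C (shift (- (j * n)%:Z) u) (shift (- (j * n)%:Z) w).
Proof.
move=> Au [bu bw uw [l [lu lw c]]]; split=> //=; first by rewrite lerD2r.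
pose l' := `|u.2 - lo|%N.
have [vu vw] : visible l' u /\ visible l' w.
  by move: lu lw; rewrite /visible /l'; lia.
rewrite (g_local _ bu bw lu lw vu vw) in c.
have l'E : l' = (l' - j * n + j * n)%N by rewrite /l'; lia.
have Al' : (A <= l' - j * n)%N by rewrite /l'; lia.
have unshift z : visible (l' - j * n) (shift (- (j * n)%:Z) z) = visible l' z /\
    g (l' - j * n)%N (shift (- (j * n)%:Z) z) = g l' z.
  rewrite -(visible_shift _ (j * n)) -(g_periodic j _ Al') -l'E.
  by rewrite /shift /= subrK; case: z.
by exists (l' - j * n)%N; rewrite !(unshift _).1 !(unshift _).2.
Qed.

(** Translates of the finite chain by multiples of [n] are glued end to end, each starting where the
    previous one stops. *)
Lemma periodic_path C (u : B * int) :
  A%:Z + lo <= u.2 -> reach C u (shift n%:Z u) ->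
  exists d : nat -> B * int,
    [/\ forall i, step true (d i) (d i.+1),
        forall m : nat, exists i, m%:Z <= (d i).2
      & ~~ C -> forall m, exists i, (m <= i)%N /\ step false (d i) (d i.+1)].
Proof.
move=> Au /reach_seq [m [e [e0 em est estrict]]].
have m_gt0 : (0 < m)%N.
  by case: m em {est estrict} => // /(congr1 snd); rewrite e0 /=; lia.
have Ae i : (i <= m)%N -> A%:Z + lo <= (e i).2.
  elim: i => [|i IH] im; first by rewrite e0.
  by apply: le_trans (IH (ltnW im)) _; case: (est i im).
pose d i := shift ((i %/ m) * n)%N%:Z (e (i %% m)%N).
(* The case [i = m] is included: the end of block [q] is the start of block [q + 1]. *)
have dE q i : (i <= m)%N -> d (q * m + i)%N = shift (q * n)%N%:Z (e i).
  rewrite leq_eqVlt => /orP[/eqP->|im]; rewrite /d; last first.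
    by rewrite divnMDl // modnMDl divn_small // modn_small // addn0.
  rewrite -mulSnr mulnK // modnMl e0 em /shift /=.
  by congr (_, _); lia.
have dst C' q i : (i < m)%N -> step C' (e i) (e i.+1) ->
    step C' (d (q * m + i)%N) (d (q * m + i).+1).
  move=> im st; rewrite -addnS !dE //; last exact: ltnW.
  by apply: step_shift => //; apply/Ae/ltnW.
exists d; split.
- move=> i; rewrite (divn_eq i m); apply: dst; rewrite ?ltn_mod //.
  by apply: est; rewrite ltn_mod.
- move=> N; exists ((N + `|u.2|) * m + 0)%N; rewrite dE //= e0.
  by rewrite PoszM PoszD; nia.
- move=> /estrict [i im st] N; exists (N * m + i)%N; split; last exact: dst.
  by nia.
Qed.

Lemma reach_period (C : bool) (d : nat -> B * int) :
  (forall i, step true (d i) (d i.+1)) ->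
  (forall m : nat, exists i, m%:Z <= (d i).2) ->
  (C \/ forall m, exists i, (m <= i)%N /\ step false (d i) (d i.+1)) ->
  exists u, [/\ inb u.1, visible A u & reach C u (shift n%:Z u)].
Proof.
move=> dst dprog dC.
have d_mono i j : (i <= j)%N -> (d i).2 <= (d j).2.
  by move=> ij; apply: reach_le (step_chain ij dst).
have binb i : inb (d i).1 by case: (dst i).
have d_jump i : (d i.+1).2 <= (d i).2 + (hi - lo).
  by case: (dst i) => _ _ _ [l []]; rewrite /visible; lia.
(* This offset puts the first threshold [pos 0] at or after the start of the path, so that a
   crossing at index 0 also falls inside its window. *)
pose J : nat := `|((d 0%N).2 - A%:Z - lo)%R|%N.
pose pos j : int := A%:Z + ((J + j) * n)%:Z + lo.
have pos0 : (d 0%N).2 <= pos 0%N by rewrite /pos /J PoszM; nia.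
have posS j : pos j.+1 = pos j + n%:Z by rewrite /pos; lia.
have pos_large i : exists j, (d i).2 < pos j.
  exists (`|(d i).2| + `|(A%:Z + lo)%R| + 1)%N; rewrite /pos PoszM !PoszD; nia.
have first_ex j : exists i, pos j <= (d i).2.
  by have [i ?] := dprog `|pos j|%N; exists i; lia.
pose cross j := ex_minn (first_ex j).
have crossP j : pos j <= (d (cross j)).2 by rewrite /cross; case: ex_minnP.
have cross_min j i : pos j <= (d i).2 -> (cross j <= i)%N.
  by rewrite /cross; case: ex_minnP => k _; apply.
have crossS j : (cross j <= cross j.+1)%N.
  by apply: cross_min; apply: le_trans (crossP j.+1); rewrite posS; lia.
(* [pos j] is the left end of this window. A step advances by at most [hi - lo], so the first vertex
   at or past [pos j] cannot overshoot the window. *)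
have cross_vis j : visible (A + (J + j) * n) (d (cross j)).
  have jE : visible (A + (J + j) * n) (d (cross j)) =
      (pos j <= (d (cross j)).2 <= pos j + (hi - lo)).
    by apply/idP/idP; rewrite /visible /pos; lia.
  rewrite jE crossP; have := @cross_min j; case: (cross j) => [|i] i_min.
    have [_ _ _ [l []]] := dst 0%N; rewrite /visible.
    by have : pos 0%N <= pos j by [rewrite /pos PoszM; nia]; lia.
  have := d_jump i; have : (d i).2 < pos j; last by lia.
  by rewrite ltNge; apply/negP => /i_min; rewrite ltnn.
(* The crossings are moved back to the window at [A], where a single valuation compares them all. *)
pose u j := shift (- ((J + j) * n)%:Z) (d (cross j)).
have uK j : d (cross j) = shift ((J + j) * n)%:Z (u j).
  by rewrite /u /shift /= subrK; case: (d _).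
have u_vis j : visible A (u j) by rewrite -(visible_shift _ ((J + j) * n)) -uK.
have u_step j : shift ((J + j.+1) * n)%:Z (u j) = shift n%:Z (d (cross j)).
  by rewrite uK /shift /=; congr (_, _); lia.
apply: NNPP => no_period.
(* If [u j.+1] were at most (or below) [u j] at [A], [reach_back] would lead from crossing [j] to
   its translate by [n]; undoing [J + j] periods would give the excluded chain. *)
have back C1 C2 j : reach C1 (d (cross j)) (d (cross j.+1)) ->
    C1 && C2 = C -> ~~ Order.lteif (g A (u j.+1)) (g A (u j)) C2.
  move=> r CE; apply/negP => c; apply: no_period; exists (u j).
  have r' : reach C (d (cross j)) (shift n%:Z (d (cross j))).
    rewrite -CE; apply: (@reach_back _ _ (A + (J + j.+1) * n) _ _ _ r) => //.
    - exact: (binb (cross j)).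
    - by rewrite -u_step visible_shift.
    - by rewrite -u_step uK !g_periodic.
    - by rewrite /=; lia.
  split=> //; first exact: (binb (cross j)).
  have -> : shift n%:Z (u j) =
      shift (- ((J + j) * n)%N%:Z) (shift n%:Z (d (cross j))).
    by rewrite /u /shift /= addrAC.
  apply: (reach_map (@step_unshift (J + j)) _ r').
  by have := crossP j; rewrite /pos; lia.
have cross_reach j : reach true (d (cross j)) (d (cross j.+1)).
  exact: step_chain.
have [L gL] := g_finite A.
(* The negated comparison reads [<] for [C] true and [<=] for [C] false; in both cases the values do
   not decrease. *)
have nd j : (g A (u j) <= g A (u j.+1))%O.
  have := back true C j (cross_reach j) erefl.
  by rewrite -lteifNE; case: (C) => //= /ltW.
have [N Nst] := @finite_nondecreasing_stabilizes _ _ L (fun j => g A (u j))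
  (fun j => gL (u j) (binb (cross j)) (u_vis j)) nd.
case: dC => [CT|dstrict].
  by have := back true C N (cross_reach N) erefl; rewrite CT /= Nst ?lexx.
have [i [Ni st]] := dstrict (cross N).
(* With the first threshold beyond the source of the strict step, that step lies between two
   consecutive crossings. *)
have := pos_large i; case/ex_minnP => j ij jmin.
have Nj : (N < j)%N.
  rewrite ltnNge; apply/negP => jN.
  have := crossP N; have := d_mono _ _ Ni.
  have : pos j <= pos N by rewrite /pos PoszM; nia.
  lia.
case: j Nj ij jmin => // j Nj ij jmin.
have ji : (cross j <= i)%N.
  by apply: cross_min; rewrite leNgt; apply/negP => /jmin; rewrite ltnn.
have ij1 : (i < cross j.+1)%N.
  by rewrite ltnNge; apply/negP => /d_mono; have := crossP j.+1; lia.
have r : reach false (d (cross j)) (d (cross j.+1)).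
  have := reach_trans (reach_step (step_chain ji dst) st) (step_chain ij1 dst).
  by [].
case CE : C.
  by have := back true C j (cross_reach j) erefl; rewrite CE /= Nst ?lexx.
by have := back false true j r (esym CE); rewrite /= Nst ?lexx.
Qed.

End Reachability.

(** * Symbolic valuations and their satisfying assignments *)

Section Valuations.

Context {disp : Order.disp_t} {D : orderType disp} {CS : constraint_system D}.
Context {V : finType} {phi : formula CS V}.

Lemma sat_lt (v : att D V -> D) t u :
  sat v (lt_constraint CS t u) <-> (v t < v u)%O.
Proof. by []. Qed.

Lemma sat_eq (v : att D V -> D) t u :
  sat v (eq_constraint CS t u) <-> v t = v u.
Proof. by []. Qed.

Lemma lt_constraint_map T (f : T -> att D V) (a b : T) :
  @Constraint _ _ CS V (SymLt CS) (map_tuple f [tuple a; b]) =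
  lt_constraint CS (f a) (f b).
Proof. by rewrite /lt_constraint; congr Constraint; apply: val_inj. Qed.

Lemma eq_constraint_map T (f : T -> att D V) (a b : T) :
  @Constraint _ _ CS V (SymEq CS) (map_tuple f [tuple a; b]) =
  eq_constraint CS (f a) (f b).
Proof. by rewrite /eq_constraint; congr Constraint; apply: val_inj. Qed.

Lemma binary_over (R : att D V -> att D V -> constraint CS V) t u :
  R = @lt_constraint _ _ CS V \/ R = @eq_constraint _ _ CS V ->
  sym_term phi t -> sym_term phi u -> constraint_over phi (R t u).
Proof. by move=> [->|->] ht hu [[|[|//]] i_lt]; rewrite (tnth_nth t). Qed.

(** Adding to [S] a constraint true under one of its models keeps it consistent, so maximality
    applies. *)
Lemma SV_complete S v k : SV phi S -> assignment v -> sat_all v S ->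
  constraint_over phi k -> sat v k -> S k.
Proof.
case=> S_over _ S_max v_asg vS k_over vk.
apply: (S_max (fun k' => S k' \/ k' = k)).
- by move=> k' [/S_over|->].
- by exists v; split=> // k' [/vS|->].
- by move=> k' Sk'; left.
- by right.
Qed.

(** The assignment is chosen per symbolic valuation rather than per position, so equal letters of
    the word get equal values and periodicity is inherited. *)
Lemma SV_valuation (rho : nat -> constraint CS V -> Prop) :
  (forall i, SV phi (rho i)) ->
  exists val : (constraint CS V -> Prop) -> att D V -> D, forall i,
    assignment (val (rho i)) /\ sat_all (val (rho i)) (rho i).
Proof.
move=> rhoSV; have [_ [v0 _] _] := rhoSV 0%N.
exists (fun S => epsilon (inhabits v0) (fun v => assignment v /\ sat_all v S)).
move=> i; have [_ rho_cons _] := rhoSV i.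
exact: (epsilon_spec _ (fun v => assignment v /\ sat_all v (rho i))).
Qed.

(** In the discrete case the constants are covered by the finite intervals between pairs of
    constants of the formula. *)
Lemma const_finite : exists L : seq D, forall c, const phi c -> c \in L.
Proof.
case: (classic (discrete D)) => [disc|ndisc]; last first.
  by exists (formula_consts phi) => c [|[]].
have intervals (s : seq (D * D)) : exists L : seq D,
    forall p c, p \in s -> (p.1 <= c <= p.2)%O -> c \in L.
  elim: s => [|p s [L hL]]; first by exists [::].
  have [M hM] := disc p.1 p.2; exists (M ++ L) => q c.
  rewrite inE mem_cat => /orP[/eqP->/hM->//|qs qc].
  by rewrite (hL q c qs qc) orbT.
have [L hL] := intervals
  [seq (a, b) | a <- formula_consts phi, b <- formula_consts phi].
exists (formula_consts phi ++ L) => c; rewrite mem_cat.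
case=> [->//|[_ [a [b [ca cb abc]]]]]; rewrite (hL (a, b)) ?orbT //.
exact: allpairs_f.
Qed.

End Valuations.

(** * From edges and points of the word to steps and chains of values *)

Section Word.

Context {disp : Order.disp_t} {D : orderType disp} {CS : constraint_system D}.
Context {V : finType} {phi : formula CS V}.
Context {rho : nat -> constraint CS V -> Prop}.
Context {val : (constraint CS V -> Prop) -> att D V -> D}.
Hypothesis rho_SV : forall i, SV phi (rho i).
Hypothesis rho_local : locally_consistent phi rho.
Hypothesis valP : forall i,
  assignment (val (rho i)) /\ sat_all (val (rho i)) (rho i).

Let g (l : nat) (u : vertex D V) : D := val (rho l) (xpow (u.2 - l%:Z) u.1).
Let vis := @visible (base D V) (ffloor phi) (fceil phi).
Let inb := @in_base _ _ _ _ phi.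
Let vstep := step inb (ffloor phi) (fceil phi) g.
Let vreach := reach inb (ffloor phi) (fceil phi) g.

Lemma visible_term l u : inb u.1 -> vis l u ->
  sym_term phi (xpow (u.2 - l%:Z) u.1).
Proof. by move=> bu lu; exists u.1, (u.2 - l%:Z). Qed.

Lemma lt_mem l u w : inb u.1 -> inb w.1 -> vis l u -> vis l w ->
  rho l (lt_constraint CS (xpow (u.2 - l%:Z) u.1) (xpow (w.2 - l%:Z) w.1)) <->
  (g l u < g l w)%O.
Proof.
move=> bu bw lu lw; have [asg vS] := valP l; split=> [/vS //|uw].
apply: (SV_complete (rho_SV l) asg vS); last exact: uw.
by apply: binary_over; [left | apply: visible_term..].
Qed.

Lemma eq_mem l u w : inb u.1 -> inb w.1 -> vis l u -> vis l w ->
  rho l (eq_constraint CS (xpow (u.2 - l%:Z) u.1) (xpow (w.2 - l%:Z) w.1)) <->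
  g l u = g l w.
Proof.
move=> bu bw lu lw; have [asg vS] := valP l; split=> [/vS //|uw].
apply: (SV_complete (rho_SV l) asg vS); last exact: uw.
by apply: binary_over; [right | apply: visible_term..].
Qed.

(** Local consistency only transfers constraints from [l] to [l.+1]. The converse follows by
    trichotomy, since [<], [=] and [>] are all transferred. *)
Lemma value_local C l u w : inb u.1 -> inb w.1 -> vis l u -> vis l w ->
  vis l.+1 u -> vis l.+1 w ->
  Order.lteif (g l u) (g l w) C = Order.lteif (g l.+1 u) (g l.+1 w) C.
Proof.
move=> bu bw lu lw lu' lw'.
have succ z : z - l%:Z - 1 = z - l.+1%:Z by lia.
have uw_vis p : p = u \/ p = w -> [/\ inb p.1, vis l p & vis l.+1 p].
  by case=> ->.
have args_over p q : p = u \/ p = w -> q = u \/ q = w -> forall j : 'I_2,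
    let a := tnth [tuple (p.1, p.2 - l%:Z); (q.1, q.2 - l%:Z)] j in
    [/\ in_base phi a.1, in_window phi a.2 & in_window phi (a.2 - 1)].
  move=> /uw_vis [? ? ?] /uw_vis [? ? ?].
  case=> [[|[|//]] j_lt] a; rewrite /a (tnth_nth (p.1, p.2 - l%:Z)) /=.
    by rewrite succ.
  by rewrite succ.
have lt_next p q : p = u \/ p = w -> q = u \/ q = w ->
    (g l p < g l q)%O -> (g l.+1 p < g l.+1 q)%O.
  move=> hp hq pq; have [_ vS] := valP l.+1.
  have := @rho_local l (SymLt CS) _ (args_over _ _ hp hq).
  rewrite !lt_constraint_map /= => next.
  have /next/vS : rho l (lt_constraint CS
      (xpow (p.2 - l%:Z) p.1) (xpow (q.2 - l%:Z) q.1)).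
    by case: (uw_vis _ hp) (uw_vis _ hq) => ? ? _ [? ? _]; apply/lt_mem.
  by rewrite /g !succ.
have eq_next : g l u = g l w -> g l.+1 u = g l.+1 w.
  move=> uw; have [_ vS] := valP l.+1.
  have := @rho_local l (SymEq CS) _
    (args_over _ _ (or_introl erefl) (or_intror erefl)).
  rewrite !eq_constraint_map /= => next.
  have /next/vS : rho l (eq_constraint CS
      (xpow (u.2 - l%:Z) u.1) (xpow (w.2 - l%:Z) w.1)).
    exact/eq_mem.
  by rewrite /g !succ.
have [uL wR] : (u = u \/ u = w) /\ (w = u \/ w = w) by split; [left | right].
case: (ltgtP (g l u) (g l w)) => [uw|wu|uw].
- have := lt_next _ _ uL wR uw; case: C => /= h;
  by rewrite ?(ltW h) ?(ltW uw) ?h ?uw.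
- have := lt_next _ _ wR uL wu; case: C => /= h;
  by rewrite ?(lt_geF h) ?(lt_geF wu) ?(lt_gtF h) ?(lt_gtF wu).
- by rewrite uw (eq_next uw) !lteifxx.
Qed.

Lemma value_finite l : exists L : seq D,
  forall u, inb u.1 -> vis l u -> g l u \in L.
Proof.
have [Lc hLc] := @const_finite _ _ _ _ phi.
pose bs : seq (base D V) := [seq inl y | y <- enum V] ++ [seq inr c | c <- Lc].
pose hs : seq int := [seq ffloor phi + i%:Z | i : nat <-
  iota 0 `|(fceil phi - ffloor phi + 1)%R|%N].
exists [seq val (rho l) (xpow h x) | x <- bs, h <- hs] => u bu lu.
apply: (allpairs_f (fun x h => val (rho l) (xpow h x))).
  rewrite mem_cat; case: (u.1) bu => [y _|c /hLc cL].
    by rewrite map_f ?mem_enum.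
  by rewrite map_f ?orbT.
apply/mapP; exists `|(u.2 - l%:Z - ffloor phi)%R|%N.
  by rewrite mem_iota; move: lu; rewrite /vis /visible; lia.
by move: lu; rewrite /vis /visible; lia.
Qed.

Lemma value_periodic A n :
  (forall l j, (A <= l)%N -> rho (l + j * n)%N = rho l) ->
  forall l j u, (A <= l)%N -> g (l + j * n)%N (shift (j * n)%:Z u) = g l u.
Proof.
move=> rho_per l j u Al; rewrite /g rho_per //=.
by congr (val _ (xpow _ _)); lia.
Qed.

(** The constraint [<] or [=] that holds under the chosen assignment belongs to [rho l], so every
    satisfying assignment orders the two terms alike. *)
Lemma entails_value C l u w : inb u.1 -> inb w.1 -> vis l u -> vis l w ->
  sym_entails (rho l) (fun a b => Order.lteif a b C)
    (xpow (u.2 - l%:Z) u.1) (xpow (w.2 - l%:Z) w.1) <->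
  Order.lteif (g l u) (g l w) C.
Proof.
move=> bu bw lu lw; have [asg vS] := valP l.
split=> [|uw v asgv vrho]; first exact.
case: (ltgtP (g l u) (g l w)) => [lt_uw|lt_wu|eq_uw].
- have /vrho/sat_lt h := proj2 (lt_mem bu bw lu lw) lt_uw.
  by apply: (@lteif_imply _ _ false).
- by move: uw; case: (C) => /=; rewrite ?(lt_geF lt_wu) ?(lt_gtF lt_wu).
- have /vrho/sat_eq h := proj2 (eq_mem bu bw lu lw) eq_uw.
  by move: uw; rewrite eq_uw h !lteifxx.
Qed.

Lemma lt_edgeP u w : inb u.1 -> inb w.1 -> u.2 <= w.2 ->
  edge phi rho (@lt_constraint _ _ CS V) u w <-> vstep false u w.
Proof.
move=> bu bw uw; split=> [[l [lu lw /lt_mem c]]|[_ _ _ [l [lu lw c]]]].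
  by split=> //; exists l; split=> //; apply: c.
by exists l; split=> //; apply/lt_mem.
Qed.

Lemma edgeP u w : inb u.1 -> inb w.1 -> u.2 <= w.2 ->
  edge phi rho (@lt_constraint _ _ CS V) u w \/
  edge phi rho (@eq_constraint _ _ CS V) u w <-> vstep true u w.
Proof.
move=> bu bw uw; rewrite lt_edgeP //; split=> [[/step_weaken //|]|].
  case=> [l [lu lw /eq_mem c]]; split=> //; exists l; split=> //.
  by rewrite lteifT c.
case=> _ _ _ [l [lu lw /=]]; rewrite le_eqVlt => /orP[/eqP c|c]; [right|left].
  by exists l; split=> //; apply/eq_mem.
by split=> //; exists l.
Qed.

Lemma forward_pathP d :
  forward_path phi rho d <-> forall i, vstep true (d i) (d i.+1).
Proof.
split=> dP i.
  by have [[b e le_i] [b' _ _]] := (dP i, dP i.+1); apply/edgeP.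
by have [b b' le_i _] := dP i; split=> //; apply/edgeP.
Qed.

Lemma strict_pathP d : forward_path phi rho d ->
  strict_path phi rho d <->
  forall m, exists i, (m <= i)%N /\ vstep false (d i) (d i.+1).
Proof.
move=> dP; split=> ds m; have [i [mi e]] := ds m; exists i; split=> //;
  have [[b _ le_i] [b' _ _]] := (dP i, dP i.+1); exact/lt_edgeP.
Qed.

Lemma strict_path_progressing d :
  forward_path phi rho d -> strict_path phi rho d -> progressing d.
Proof.
move=> dP ds; apply: (strict_progressing value_local value_finite).
  exact/forward_pathP.
exact/strict_pathP.
Qed.

Definition vertex_of (p : point D V) : vertex D V := (pvar p, ppos p).

Definition chain (C : bool) : point D V -> point D V -> Prop :=
  if C then preceq_chain phi rho else prec_chain phi rho.

Lemma point_visible p : is_point phi p -> vis (psv p) (vertex_of p).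
Proof.
by case=> _; rewrite /vis /visible /vertex_of /ppos /in_window /=; lia.
Qed.

Lemma point_step_refl p :
  is_point phi p -> vstep true (vertex_of p) (vertex_of p).
Proof.
move=> pp; have [bp _] := pp; split=> //; exists (psv p).
by rewrite lteifxx; split=> //; apply: point_visible.
Qed.

Lemma point_relP C p q :
  point_rel phi rho (fun a b => Order.lteif a b C) p q <->
  [/\ is_point phi p, is_point phi q & vstep C (vertex_of p) (vertex_of q)].
Proof.
split=> [[[pp pq] _ pos_le [l [lp lq c]]]|[pp pq [bp bq pos_le [l [lp lq c]]]]].
  case: (pp) (pq) => bp _ [bq _]; split=> //; split=> //; exists l; split=> //.
  by apply/entails_value.
(* Two positions in a common window differ by at most [fceil phi - ffloor phi], which is below
   [lambda phi]. *)
split=> //; first by move: lp lq; rewrite /visible /lambda /=; lia.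
by exists l; split=> //; apply/(@entails_value C l (vertex_of p) (vertex_of q)).
Qed.

Lemma chain_trans C C' p q r : chain C p q ->
  point_rel phi rho (fun a b => Order.lteif a b C') q r -> chain (C && C') p r.
Proof.
case: C C' => [] [] /=.
- by move=> pq qr; apply: (t_trans _ _ _ q) => //; apply: t_step.
(* [prec_chain] needs a nonempty chain after its strict step; a reflexive step at [r] supplies
   it. *)
- move=> pq qr; exists q, r; split=> //; apply: t_step.
  apply/(point_relP true); have /(point_relP false) [_ pr _] := qr.
  by split=> //; apply: point_step_refl.
- move=> [p' [p'' [? ? pq]]] qr; exists p', p''; split=> //.
  by apply: (t_trans _ _ _ q) => //; apply: t_step.
- move=> [p' [p'' [? ? pq]]] qr; exists p', p''; split=> //.
  apply: (t_trans _ _ _ q) => //; apply: t_step.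
  apply/(point_relP true); have /(point_relP false) [? ? /step_weaken] := qr.
  by split.
Qed.

(** A vertex is represented by several points, so the endpoints range over all representatives; even
    an empty chain becomes one non-strict step between two of them. *)
Lemma reach_chain C u w : vreach C u w -> forall p q,
  is_point phi p -> is_point phi q -> vertex_of p = u -> vertex_of q = w ->
  chain C p q.
Proof.
elim=> [{}u|C1 C2 {}u w' {}w _ IH st] p q pp pq pu qw.
  apply: t_step; apply/(point_relP true); split=> //.
  by rewrite qw -pu; apply: point_step_refl.
have [bw' _ _ [l [lw' _ _]]] := st.
have w'P : vertex_of (Point w'.1 l (w'.2 - l%:Z)) = w'.
  by rewrite /vertex_of /ppos /= addrC subrK; case: (w').
have pw' : is_point phi (Point w'.1 l (w'.2 - l%:Z)) by split.
apply: (chain_trans (IH p _ pp pw' pu w'P)); apply/point_relP.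
by rewrite w'P qw.
Qed.

Lemma chain_reach C p q : chain C p q -> vreach C (vertex_of p) (vertex_of q).
Proof.
have nonstrict p' q' : preceq_chain phi rho p' q' ->
    vreach true (vertex_of p') (vertex_of q').
  elim=> [{}p' {}q' /(point_relP true) [_ _ /reach1 //]|].
  by move=> a b c _ ab _ bc; apply: reach_trans ab bc.
case: C => [/nonstrict //|[p' [p'' [pp' /(point_relP false) [_ _ st] pq]]]].
exact: reach_trans (reach_step (nonstrict _ _ pp') st) (nonstrict _ _ pq).
Qed.

Lemma periodic_chainP (C : bool) (A n : nat) : (0 < n)%N ->
  (forall l j, (A <= l)%N -> rho (l + j * n)%N = rho l) ->
  (exists d, [/\ forward_path phi rho d, progressing d
               & C \/ strict_path phi rho d]) <->
  (exists p p' : point D V,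
      is_point phi p /\ is_point phi p' /\
      psv p = A /\ psv p' = (A + n)%N /\
      point_equiv n p p' /\ chain C p p').
Proof.
move=> n_gt0 rho_per; have g_per := value_periodic rho_per; split.
  move=> [d [dP dprog dC]].
  have [|u [bu Au]] := reach_period value_local value_finite n_gt0 g_per
    (proj1 (forward_pathP d) dP) dprog (C := C).
    by case: dC => [|/(strict_pathP dP)]; [left | right].
  pose p := Point u.1 A (u.2 - A%:Z).
  pose p' := Point u.1 (A + n) (u.2 - A%:Z).
  have [pp pp'] : is_point phi p /\ is_point phi p' by [].
  move=> /reach_chain/(_ p p' pp pp') r.
  exists p, p'; do !split=> //; first by exists 1; rewrite /=; lia.
  apply: r; rewrite /vertex_of /ppos /shift /=; last by congr (_, _); lia.
  by rewrite addrC subrK; case: (u).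
move=> [p [p' [pp [pp' [pA [p'A [[pvarE pshiftE _] /chain_reach r]]]]]]].
have p'E : vertex_of p' = shift n%:Z (vertex_of p).
  rewrite /vertex_of /shift /ppos pA p'A -pvarE -pshiftE /=.
  by congr (_, _); lia.
rewrite p'E in r.
have Ap : A%:Z + ffloor phi <= (vertex_of p).2.
  by have := point_visible pp; rewrite pA /vis /visible; lia.
have [d [dst dprog dC]] := periodic_path value_local n_gt0 g_per Ap r.
have dP : forward_path phi rho d by apply/forward_pathP.
exists d; split=> //; case: C dC {r} => dC; first by left.
by right; apply/strict_pathP => //; apply: dC.
Qed.

End Word.

(** Since both words end in [s], the word is also [a] followed by copies of [s] and [b], so its
    period already starts at the last letter of the prefix. *)
Lemma lasso_periodic (T : Type) (x0 s : T) (a b : seq T) (l j : nat) :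
  (size a <= l)%N ->
  lasso x0 (rcons a s) (rcons b s) (l + j * (size b).+1) =
  lasso x0 (rcons a s) (rcons b s) l.
Proof.
have block m l' : l' = (size a + m * (size b).+1)%N ->
    lasso x0 (rcons a s) (rcons b s) l' = s.
  move=> ->; rewrite /lasso !size_rcons; case: m => [|m].
    by rewrite mul0n addn0 ltnSn nth_rcons ltnn eqxx.
  rewrite ltnNge; have -> : (size a < size a + m.+1 * (size b).+1)%N by nia.
  rewrite /=.
  have -> : (size a + m.+1 * (size b).+1 - (size a).+1 =
             m * (size b).+1 + size b)%N by rewrite mulSn; lia.
  by rewrite modnMDl modn_small // nth_rcons ltnn eqxx.
rewrite leq_eqVlt => /orP[/eqP al|al].
  by rewrite (block j) ?al // (block 0%N) // mul0n addn0.
have pre_l m : (l + m < (size a).+1)%N = false by lia.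
rewrite /lasso !size_rcons pre_l -[l in (l < _)%N]addn0 pre_l.
by rewrite addnC -addnBA // modnMDl.
Qed.

Theorem theorem4 (disp : Order.disp_t) (D : orderType disp)
    (CS : constraint_system D) (V : finType) (phi : formula CS V)
    (alpha alpha' beta beta' : seq (constraint CS V -> Prop))
    (s : constraint CS V -> Prop)
    (rho : nat -> constraint CS V -> Prop) (k : nat)
    (Halpha : alpha = rcons alpha' s) (Hbeta : beta = rcons beta' s)
    (Hrho : rho = lasso s alpha beta)
    (HSV : forall i : nat, SV phi (rho i))
    (Hlocal : locally_consistent phi rho)
    (Hk : k = (size (alpha ++ beta) - 1)%N) :
  ((exists d : nat -> vertex D V, forward_path phi rho d /\ progressing d)
   <->
   (exists p p' : point D V,
      is_point phi p /\ is_point phi p' /\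
      psv p = size alpha' /\ psv p' = k /\
      point_equiv (size beta) p p' /\ preceq_chain phi rho p p'))
  /\
  ((exists d : nat -> vertex D V, forward_path phi rho d /\ strict_path phi rho d)
   <->
   (exists p p' : point D V,
      is_point phi p /\ is_point phi p' /\
      psv p = size alpha' /\ psv p' = k /\
      point_equiv (size beta) p p' /\ prec_chain phi rho p p')).
Proof.
have n_gt0 : (0 < size beta)%N by rewrite Hbeta size_rcons.
have rho_per l j : (size alpha' <= l)%N ->
    rho (l + j * size beta)%N = rho l.
  rewrite Hrho Halpha Hbeta [X in (_ + _ * X)%N]size_rcons.
  exact: lasso_periodic.
(* Hence [p'] sits exactly one period after [p]. *)
have kE : k = (size alpha' + size beta)%N.
  by rewrite Hk Halpha size_cat size_rcons addSn subn1.
have [val valP] := SV_valuation HSV.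
have main C := periodic_chainP HSV Hlocal valP C n_gt0 rho_per.
rewrite kE; split; [rewrite -(main true) | rewrite -(main false)].
  by split=> [] [d] [dP dprog]; exists d; [split=> //; left | ].
split=> [] [d] []; last by move=> dP _ [//|ds]; exists d.
move=> dP ds; exists d; split=> //; last by right.
(* Strictness alone forces the path to advance, which supplies the progress required by
   [periodic_chainP]. *)
exact: (strict_path_progressing HSV Hlocal valP).
Qed.
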